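(* Assume that $\mathfrak{b}=\operatorname{cov}(\mathcal{M})<\mathfrak{d}$. Then (Setting (4.a)) there is a subgroup of $\mathbb{Z}^{\mathbb{N}}$ which is Hurewicz-bounded, Menger-bounded, and Rothberger-bounded, and has the Menger property, but does not have the Hurewicz property and does not have the Rothberger property.
   Context: For $f,g\in\mathbb{N}^{\mathbb{N}}$, $f\le^* g$ means $f(n)\le g(n)$ for all but finitely many $n$. $\mathfrak{b}$ is the minimal cardinality of a $\le^*$-unbounded subset of $\mathbb{N}^{\mathbb{N}}$; $\mathfrak{d}$ is the minimal cardinality of a dominating $D\subseteq\mathbb{N}^{\mathbb{N}}$ (for each $g\in\mathbb{N}^{\mathbb{N}}$ there is $f\in D$ with $g\le^* f$); $\operatorname{cov}(\mathcal{M})$ is the minimal cardinality of a cover of $\mathbb{R}$ by meager sets, equivalently, of $Y\subseteq\mathbb{N}^{\mathbb{N}}$ such that there is no $f\in\mathbb{N}^{\mathbb{N}}$ with the property that for each $y\in Y$, $f(n)=y(n)$ for some $n$. The group $\mathbb{Z}^{\mathbb{N}}$ carries pointwise addition and the product topology ($\mathbb{Z}$ discrete); subgroups carry the subspace topology. For a topological group $(G,\cdot)$, with the condition required for each sequence $(U_n)_{n\in\mathbb{N}}$ of neighborhoods of the unit: $G$ is Menger-bounded if there are finite $F_n\subseteq G$ with $G=\bigcup_n F_n\cdot U_n$; Hurewicz-bounded if there are finite $F_n\subseteq G$ such that each $g\in G$ belongs to $F_n\cdot U_n$ for all but finitely many $n$; Rothberger-bounded if there are $a_n\in G$ with $G=\bigcup_n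 a_n\cdot U_n$. For a topological space $X$, with the condition required for each sequence $(\mathcal{U}_n)_{n\in\mathbb{N}}$ of open covers of $X$: $X$ has the Menger property if there are finite $\mathcal{F}_n\subseteq\mathcal{U}_n$ such that $\bigcup_n\mathcal{F}_n$ covers $X$; the Hurewicz property if there are finite $\mathcal{F}_n\subseteq\mathcal{U}_n$ such that each $x\in X$ belongs to $\bigcup_{U\in\mathcal{F}_n}U$ for all but finitely many $n$; the Rothberger property if there are $U_n\in\mathcal{U}_n$ with $X=\bigcup_n U_n$. *)

(* Defs.v *)
From HB Require Import structures.
From mathcomp Require Import all_boot all_order all_algebra.
From mathcomp Require Import all_classical all_reals all_analysis.

Set Implicit Arguments.
Unset Strict Implicit.
Unset Printing Implicit Defensive.

Import Order.TTheory GRing.Theory Num.Theory.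
Import numFieldNormedType.Exports.

Local Open Scope classical_set_scope.
Local Open Scope card_scope.

(* Cardinals are represented by sets: a minimal cardinality is given by a set
   [A] attaining it (see [min_card_witness]), and two such cardinals are
   compared through [#=] and [#<]. *)
Definition card_lt T U (A : set T) (B : set U) : Prop :=
  A #<= B /\ ~ (B #<= A).

Notation "A '#<' B" := (card_lt A B) (at level 79) : card_scope.

Definition min_card_witness T (P : set T -> Prop) (A : set T) : Prop :=
  P A /\ forall B : set T, P B -> A #<= B.

Definition le_star (f g : nat -> nat) : Prop :=
  \forall n \near \oo, (f n <= g n)%N.

Definition unbounded (B : set (nat -> nat)) : Prop :=
  ~ exists g, forall f, B f -> le_star f g.

Definition dominating (D : set (nat -> nat)) : Prop :=
  forall g, exists2 f, D f & le_star g f.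

Definition nowhere_dense (X : topologicalType) (A : set X) : Prop :=
  (closure A)° = set0.

Definition meager (X : topologicalType) (A : set X) : Prop :=
  exists2 N : nat -> set X,
    (forall n, nowhere_dense (N n)) & A = \bigcup_n N n.

Definition meager_cover (X : topologicalType) (C : set (set X)) : Prop :=
  (forall A, C A -> meager A) /\ \bigcup_(A in C) A = setT.

Section CoveringProperties.
Variable X : topologicalType.

Definition open_cover (U : set (set X)) : Prop :=
  (forall V, U V -> open V) /\ \bigcup_(V in U) V = setT.

Definition Menger : Prop :=
  forall U : nat -> set (set X), (forall n, open_cover (U n)) ->
  exists F : nat -> set (set X),
    (forall n, finite_set (F n) /\ F n `<=` U n) /\
    \bigcup_n \bigcup_(V in F n) V = setT.

Definition Hurewicz : Prop :=
  forall U : nat -> set (set X), (forall n, open_cover (U n)) ->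
  exists F : nat -> set (set X),
    (forall n, finite_set (F n) /\ F n `<=` U n) /\
    forall x, \forall n \near \oo, (\bigcup_(V in F n) V) x.

Definition Rothberger : Prop :=
  forall U : nat -> set (set X), (forall n, open_cover (U n)) ->
  exists V : nat -> set X,
    (forall n, U n (V n)) /\ \bigcup_n V n = setT.

End CoveringProperties.

(* Additive notation: every group considered is a subgroup of Z^N. *)
Section BoundednessProperties.
Local Open Scope ring_scope.
Variable G : topologicalZmodType.

Definition Menger_bounded : Prop :=
  forall U : nat -> set G, (forall n, nbhs (0 : G) (U n)) ->
  exists F : nat -> set G,
    (forall n, finite_set (F n)) /\
    \bigcup_n [set a + u | a in F n & u in U n] = setT.

Definition Hurewicz_bounded : Prop :=
  forall U : nat -> set G, (forall n, nbhs (0 : G) (U n)) ->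
  exists F : nat -> set G,
    (forall n, finite_set (F n)) /\
    forall g, \forall n \near \oo, [set a + u | a in F n & u in U n] g.

Definition Rothberger_bounded : Prop :=
  forall U : nat -> set G, (forall n, nbhs (0 : G) (U n)) ->
  exists a : nat -> G, \bigcup_n [set a n + u | u in U n] = setT.

End BoundednessProperties.

Section Subgroup.
Local Open Scope ring_scope.
Variables (M : topologicalZmodType) (S : zmodClosed M).

Definition subgroup : Type := {x : M | x \in S}.

HB.instance Definition _ := SubChoice.on subgroup.
HB.instance Definition _ := [SubChoice_isSubZmodule of subgroup by <:].
HB.instance Definition _ :=
  Topological.copy subgroup (initial_topology (val : subgroup -> M)).

Lemma subgroup_val_continuous : continuous (val : subgroup -> M).
Proof. exact: initial_continuous. Qed.

Lemma subgroup_sub_continuous :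
  continuous (fun x : subgroup * subgroup => x.1 - x.2).
Proof.
apply: (@continuous_comp_initial _ _ _ (val : subgroup -> M)) => -[x y].
apply: (@cvg_comp _ _ _ (fun z : subgroup * subgroup => (val z.1, val z.2))
  (fun z : M * M => z.1 - z.2) _ (nbhs (val x, val y))).
  apply: cvg_pair => /=.
    apply: (@cvg_comp _ _ _ fst (val : subgroup -> M) _ (nbhs x)).
      exact: cvg_fst.
    exact: subgroup_val_continuous.
  apply: (@cvg_comp _ _ _ snd (val : subgroup -> M) _ (nbhs y)).
    exact: cvg_snd.
  exact: subgroup_val_continuous.
exact: (@sub_continuous M (val x, val y)).
Qed.

HB.instance Definition _ :=
  PreTopologicalNmodule_isTopologicalZmodule.Build subgroup
    subgroup_sub_continuous.

End Subgroup.

Definition ZN : Type := {ptws nat -> discrete_topology int}.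

HB.instance Definition _ := Topological.on ZN.
HB.instance Definition _ := GRing.Zmodule.copy ZN (nat -> int).

(* Typeclass resolution does not terminate on these goals otherwise. *)
#[global] Instance ZN_nbhs_filter (f : ZN) : ProperFilter (nbhs f) | 0.
Proof. exact: nbhs_pfilter. Qed.

#[global] Instance ZN2_nbhs_filter (f : ZN * ZN) : ProperFilter (nbhs f) | 0.
Proof. exact: nbhs_pfilter. Qed.

Lemma ZN_cvg (F : set_system ZN) (f : ZN) : Filter F ->
  (forall i (A : set (discrete_topology int)), nbhs (f i) A ->
    F [set g | A (g i)]) -> F --> f.
Proof.
move=> FF cF; apply/cvg_sup => i A [_ [[B oB <-] Bf BA]].
by apply: (filterS BA); apply: cF; exact: open_nbhs_nbhs.
Qed.

Lemma ZN_nbhs_proj (f : ZN) (i : nat) : nbhs f [set g : ZN | g i = f i].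
Proof.
exact: (@proj_continuous _ (fun=> discrete_topology int) i f _
  (@discrete_set1 (discrete_topology int) (f i))).
Qed.

Lemma ZN_sub_continuous : continuous (fun x : ZN * ZN => (x.1 - x.2)%R).
Proof.
move=> [f g]; apply: ZN_cvg => i A Afg.
exists ([set h : ZN | h i = f i], [set h : ZN | h i = g i]).
  by split; exact: ZN_nbhs_proj.
move=> [u v] /= [uf vg].
by rewrite !fctE uf vg; exact: nbhs_singleton Afg.
Qed.

HB.instance Definition _ :=
  PreTopologicalNmodule_isTopologicalZmodule.Build ZN ZN_sub_continuous.

(* Main.v *)
(* Let kappa = b = cov(M) < d.  Index by a set [A] of size kappa a family of sequences
   w_i = (y_i, s_i) of pairs of naturals, where no sequence agrees infinitely often with
   every y_i (kappa meager sets cover R, and kappa < d), and where the s_i form a kind of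
   b-scale: for each b, off a set of fewer than kappa indices, all s_i exceed b at almost
   all points of one common infinite set.  Index the coordinates of Z^N by the nodes of
   the tree of finite sequences and let G be generated by the characteristic functions of
   the branches w_i.

   G consists of bounded functions, hence is Hurewicz-bounded, and it has the Menger
   property since |G| < d.  On each level of the tree the coordinates of g in G add up to
   its coordinate at the root.  So, for each n, the sets "g vanishes at the root or not
   at t", with t of length n, form an open cover; as only the node on the branch itself
   gives a set containing the generator w_i, applying the Hurewicz (Rothberger) property
   to these covers would bound all the s_i (guess all the y_i).  Rothberger-boundedness
   combines guessing, for the part of g made of fewer than kappa generators, with long
   gaps in the support of the rest of g. *)
From HB Require Import structures.
Require Import Defs.
From mathcomp Require Import all_boot all_order all_algebra.
From mathcomp Require Import all_classical all_reals all_analysis.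
From mathcomp Require Import zify ring lra.

Set Implicit Arguments.
Unset Strict Implicit.
Unset Printing Implicit Defensive.

Import Order.TTheory GRing.Theory Num.Theory.
Import numFieldNormedType.Exports.

Local Open Scope classical_set_scope.
Local Open Scope card_scope.

(** * Cardinality of the set of words over an infinite set *)

Lemma card_le_inj (T U : Type) (A : set T) (B : set U) (f : T -> U) :
  set_fun A B f -> set_inj A f -> A #<= B.
Proof.
by move=> fAB finj; have /injfunPex[g] : exists2 g, set_fun A B g & set_inj A g;
  [exists f|exact: inj_card_le].
Qed.

Lemma card_le_injP (T : Type) (U : pointedType) (A : set T) (B : set U) :
  A #<= B <-> exists2 f : T -> U, set_fun A B f & set_inj A f.
Proof. by split=> [/pcard_leP /injfunPex//|H]; apply/pcard_leP/injfunPex. Qed.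

Section Comparability.
Variables (T U : pointedType) (A : set T) (B : set U).

Let partial_injection (G : set (T * U)) :=
  [/\ forall x y, G (x, y) -> A x /\ B y,
      forall x y y', G (x, y) -> G (x, y') -> y = y' &
      forall x x' y, G (x, y) -> G (x', y) -> x = x'].

(** A maximal partial injection, given by Zorn's lemma, cannot miss both some [a] in [A] and some
    [b] in [B]: the pair [(a, b)] could be added. *)
Lemma card_le_total : A #<= B \/ B #<= A.
Proof.
have [F Fpi totF|G [[GAB Gfun Ginj] Gmax]] := @Zorn_bigcup _ partial_injection.
  have common p q : (\bigcup_(X in F) X) p -> (\bigcup_(X in F) X) q ->
      exists X, [/\ F X, X p & X q].
    move=> [X FX Xp] [Y FY Yq].
    by have [XY|YX] := totF X Y FX FY; [exists Y|exists X]; split=> //;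
      [exact: XY|exact: YX].
  split.
  - by move=> x y [X FX Xxy]; have [+ _ _] := Fpi X FX; apply.
  - move=> x y y' Gxy Gxy'; have [X [FX Xxy Xxy']] := common _ _ Gxy Gxy'.
    by have [_ + _] := Fpi X FX; apply; eauto.
  - move=> x x' y Gxy Gxy'; have [X [FX Xxy Xxy']] := common _ _ Gxy Gxy'.
    by have [_ _ +] := Fpi X FX; apply; eauto.
have [domA|/existsNP[a /not_implyP[Aa aG]]] :=
    pselect (forall a, A a -> exists b, G (a, b)).
  left; apply/card_le_injP.
  have /choice[f fP] a : exists b, A a -> G (a, b).
    by have [/domA[b ?]|] := pselect (A a); [exists b|exists point].
  exists f => [a Aa|a a' /set_mem Aa /set_mem Aa' faa'].
    by have /GAB[] := fP a Aa.
  by apply: (Ginj _ _ (f a)); [exact: fP|rewrite faa'; exact: fP].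
have [domB|/existsNP[b /not_implyP[Bb bG]]] :=
    pselect (forall b, B b -> exists a, G (a, b)).
  right; apply/card_le_injP.
  have /choice[f fP] b : exists a, B b -> G (a, b).
    by have [/domB[a' ?]|] := pselect (B b); [exists a'|exists point].
  exists f => [b Bb|b b' /set_mem Bb /set_mem Bb' fbb'].
    by have /GAB[] := fP b Bb.
  by apply: (Gfun (f b)); [exact: fP|rewrite fbb'; exact: fP].
exfalso; apply: (Gmax (G `|` [set (a, b)])).
  split=> [p Gp|/(_ (a, b) (or_intror erefl)) Gab]; first by left.
  by apply: aG; exists b.
split.
- by move=> x y [/GAB//|[-> ->]].
- move=> x y y' [Gxy|[? ?]] [Gxy'|[? ?]]; subst => //.
  + exact: Gfun Gxy Gxy'.
  + by exfalso; apply: aG; exists y.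
  + by exfalso; apply: aG; exists y'.
- move=> x y y' [Gxy|[? ?]] [Gxy'|[? ?]]; subst => //.
  + exact: Ginj Gxy Gxy'.
  + by exfalso; apply: bG; exists x.
  + by exfalso; apply: bG; exists y.
Qed.

End Comparability.

Section Words.
Variable T : pointedType.
Implicit Types A : set T.

Definition words A : set (seq T) := [set l : seq T | forall x, x \in l -> A x].

Definition signed_words A : set (seq (bool * T)) :=
  [set l : seq (bool * T) | forall p, p \in l -> A p.2].

(** Each signed letter becomes two letters: its sign, written as [a] or [b], then the letter
    itself. *)
Lemma signed_words_card A a b : A a -> A b -> a <> b ->
  signed_words A #<= words A.
Proof.
move=> Aa Ab ab; 
pose code := flatten \o map (fun p : bool * T => [:: if p.1 then a else b; p.2]).
apply: (@card_le_inj _ _ _ _ code) => [l Al x /=|].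
  move=> /flatten_mapP[p pl]; rewrite !inE => /orP[]/eqP->; last exact: Al.
  by case: ifP.
suff codeI : injective code by move=> x y _ _ /codeI.
elim=> [|[s x] l IH] [|[s' x'] l']//= [ss' -> /IH->].
by case: s s' ss' => -[]// e; exfalso; exact: ab.
Qed.


(** The sign records whether a letter lies in [B]; the other letters are injected into [B]. *)
Lemma words_split A B : A `\` B #<= B -> words A #<= signed_words B.
Proof.
move=> /card_le_injP[f fB finj].
pose code := map (fun x => (`[< B x >], if `[< B x >] then x else f x)).
apply: (@card_le_inj _ _ _ _ code) => [l Al p /mapP[x xl ->]/=|].
  by case: asboolP => // Bx; apply: fB; split=> //; exact: Al.
move=> l l' /set_mem Al /set_mem Al'.
elim: l l' Al Al' => [|x l IH] [|x' l']//= Al Al' [e e'] /IH-> //.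
- congr cons; case: asboolP e' e => [Bx|Bx]; case: asboolP => // Bx' E _.
  by apply: finj => //; rewrite inE; split => //; [apply: Al|apply: Al'];
    rewrite /= inE eqxx.
- by move=> z zl; apply: Al; rewrite /= inE zl orbT.
- by move=> z zl; apply: Al'; rewrite /= inE zl orbT.
Qed.

(* [coding A G] states that [G] is the graph of an injective map from the nonempty words
   over a subset of [A], the letters of [G], to these letters. *)
Let letters (G : set (seq T * T)) := [set x | exists y, G ([:: x], y)].

Let coding A (G : set (seq T * T)) :=
  [/\ letters G `<=` A,
      forall l y, G (l, y) -> words (letters G) l /\ letters G y,
      forall l y y', G (l, y) -> G (l, y') -> y = y',
      forall l l' y, G (l, y) -> G (l', y) -> l = l' &
      forall l, words (letters G) l -> l != [::] -> exists y, G (l, y)].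

(** The finitely many letters of a nonempty word all belong to one member of the chain. Leaving out
    the empty word makes the empty graph a coding, as the empty chain requires. *)
Lemma coding_bigcup A (F : set (set (seq T * T))) : F `<=` coding A ->
  total_on F subset -> coding A (\bigcup_(X in F) X).
Proof.
move=> Fc totF.
have common p q : (\bigcup_(X in F) X) p -> (\bigcup_(X in F) X) q ->
    exists X, [/\ F X, X p & X q].
  move=> [X FX Xp] [Y FY Yq].
  by have [XY|YX] := totF X Y FX FY; [exists Y|exists X]; split=> //;
    [exact: XY|exact: YX].
have lettersU X : F X -> letters X `<=` letters (\bigcup_(X in F) X).
  by move=> FX x [y Xxy]; exists y, X.
split.
- by move=> x [y [X FX Xxy]]; have [+ _ _ _ _] := Fc X FX; apply; exists y.
- move=> l y [X FX Xly]; have [_ /(_ _ _ Xly)[Xl Xy] _ _ _] := Fc X FX.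
  by split; [move=> x /Xl|]; exact: (lettersU _ FX).
- move=> x y y' Gxy Gxy'; have [X [FX Xxy Xxy']] := common _ _ Gxy Gxy'.
  by have [_ _ + _ _] := Fc X FX; apply; eauto.
- move=> x x' y Gxy Gxy'; have [X [FX Xxy Xxy']] := common _ _ Gxy Gxy'.
  by have [_ _ _ + _] := Fc X FX; apply; eauto.
- move=> l Ul l0.
  suff [X FX Xl] : exists2 X, F X & words (letters X) l.
    have [_ _ _ _ /(_ l Xl l0)[y Xly]] := Fc X FX.
    by exists y, X.
  elim: l Ul l0 => // x l IH Ul _.
  have [y [X FX Xxy]] := Ul x (mem_head _ _).
  have [l0|l0] := eqVneq l [::].
    by exists X => // z; rewrite l0 /= inE => /eqP->; exists y.
  have [|Y FY Yl] := IH _ l0; first by move=> z zl; apply: Ul; rewrite /= inE zl orbT.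
  have [XY|YX] := totF X Y FX FY.
    exists Y => // z /=; rewrite inE => /orP[/eqP->|/Yl//].
    by exists y; exact: XY.
  exists X => // z /=; rewrite inE => /orP[/eqP->|/Yl[t Yt]].
    by exists y.
  by exists t; exact: YX.
Qed.

(** Let [X] be the letters of a maximal coding. If [X] embedded in the rest of [A], its copy there
    could code the new words, against maximality. So the rest embeds in [X], and words over [A]
    become signed words over [X], then words over [X], then letters. *)
Lemma words_card A : infinite_set A -> words A #<= A.
Proof.
move=> Ainf; have [G [Gc Gmax]] := Zorn_bigcup (@coding_bigcup A).
pose X := letters G.
have [XA GX Gfun Ginj Gtot] := Gc.
have [c cP] : exists c : seq T -> T, forall l, words X l -> l != [::] -> G (l, c l).
  have /choice[c cP] : forall l, exists y, words X l -> l != [::] -> G (l, y).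
    move=> l; have [[Xl l0]|H] := pselect (words X l /\ l != [::]).
      by have [y Gly] := Gtot l Xl l0; exists y.
    by exists point => Xl l0; exfalso; apply: H.
  by exists c.
(* An injective coding of the words over [X `|` Y] by letters of [Y] for the words
   outside [words X] extends [G]. *)
have extend Y : Y `<=` A -> (forall y, Y y -> ~ X y) -> Y !=set0 ->
    words (X `|` Y) #<= Y -> False.
  move=> YA YX [y0 Yy0] /card_le_injP[f fY finj].
  pose G' := G `|` [set p | [/\ words (X `|` Y) p.1, ~ words X p.1 & p.2 = f p.1]].
  have wX l : words X l -> words (X `|` Y) l by move=> Xl x /Xl; left.
  have lettersG' : letters G' = X `|` Y.
    apply/seteqP; split=> x.
      move=> [y [Gxy|[/= + _ _]]]; first by left; exists y.
      by apply; rewrite /= inE.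
    move=> [[y Gxy]|Yx]; first by exists y; left.
    exists (f [:: x]); right; split=> //= [z|].
      by rewrite /= inE => /eqP->; right.
    by move/(_ x); rewrite /= inE eqxx => /(_ isT); exact: YX.
  have Gf l l' : G (l, f l') -> words (X `|` Y) l' -> False.
    by move=> /GX[_ Xf] /fY /YX /(_ Xf).
  apply: (Gmax G').
    split=> [p Gp|/(_ ([:: y0], f [:: y0])) G'G]; first by left.
    have : G ([:: y0], f [:: y0]).
      apply: G'G; right; split=> //=.
        by move=> z; rewrite /= inE => /eqP->; right.
      by move/(_ y0); rewrite /= inE eqxx => /(_ isT); exact: YX.
    by move=> Gy0; apply: (YX y0) => //; exists (f [:: y0]).
  split; rewrite ?lettersG'.
  - by move=> x [/XA//|/YA].
  - move=> l y [/GX[Xl Xy]|[/= XYl _ ->]]; first by split; [exact: wX|left].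
    by split => //; right; exact: fY.
  - move=> l y y' [Gly|[/= Yl Xl ->]] [Gly'|[/= Yl' Xl' ->]] //.
    + exact: Gfun Gly Gly'.
    + by have /GX[] := Gly.
    + by have /GX[] := Gly'.
  - move=> l l' y [Gly|[/= Yl Xl E]] [Gly'|[/= Yl' Xl' E']].
    + exact: Ginj Gly Gly'.
    + by exfalso; apply: (@Gf l l') => //; rewrite -E'.
    + by exfalso; apply: (@Gf l' l) => //; rewrite -E.
    + by apply: finj; rewrite ?inE // -E -E'.
  - move=> l XYl l0; have [Xl|Xl] := pselect (words X l).
      by have [y ?] := Gtot l Xl l0; exists y; left.
    by exists (f l); right.
have [X0|/set0P[x0 Xx0]] := eqVneq X set0.
  exfalso; have /infiniteP/card_le_injP[e eA einj] := Ainf.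
  have Ye : range e #= [set: nat] by apply: inj_card_eq => ? ? _ _ /einj; apply; rewrite ?inE.
  apply: (extend (range e)).
  - by move=> _ [n _ <-]; exact: eA.
  - by move=> y _; rewrite X0.
  - by exists (e 0%N), 0%N.
  - rewrite X0 set0U (card_le_eqr Ye).
    apply: (@card_le_inj _ _ _ _ (fun l => pickle (map (pinv setT e) l))) => //.
    move=> l l' /set_mem el /set_mem el' /(pcan_inj pickleK).
    move=> E; rewrite -[l]map_id -[l']map_id.
    have K l1 : words (range e) l1 -> map id l1 = map (e \o pinv setT e) l1.
      move=> el1; apply/eq_in_map => x /el1 [n _ <-] /=.
      by rewrite pinvK ?inE//; exact: imageP.
    by rewrite !K// 2!map_comp E.
have Xx00 : words X [:: x0; x0] by move=> z /=; rewrite !inE => /orP[]/eqP->.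
have Xx0' : words X [:: x0] by move=> z /=; rewrite inE => /eqP->.
have [/GX[_ Xa] /GX[_ Xb]] := (cP _ Xx0' isT, cP _ Xx00 isT).
have ab : c [:: x0] <> c [:: x0; x0].
  move=> E; have := cP _ Xx0' isT; rewrite E => /Ginj/(_ (cP _ Xx00 isT)).
  by [].
have wX : words X #<= X.
  (* Putting [x0] in front disposes of the empty word, which need not have a code. *)
  apply: card_le_trans (_ : words X `\` [set [::]] #<= _).
    apply: (@card_le_inj _ _ _ _ (cons x0)) => [l Xl|l l' _ _ [//]].
    by split=> // z /=; rewrite inE => /orP[/eqP->//|/Xl].
  apply: (@card_le_inj _ _ _ _ c) => [l [Xl /eqP l0]|].
    by have /GX[] := cP l Xl l0.
  move=> l l'; rewrite !inE => -[Xl /eqP l0] [Xl' /eqP l0'] E.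
  by apply: (Ginj _ _ (c l)); [exact: cP|rewrite E; exact: cP].
have sX : signed_words X #<= X.
  exact: card_le_trans (signed_words_card Xa Xb ab) wX.
have [XD|DX] := card_le_total X (A `\` X); last first.
  apply: card_le_trans (subset_card_le XA).
  exact: card_le_trans (words_split DX) sX.
have /card_le_injP[f fD finj] := XD; exfalso.
have fX : f @` X #= X by exact: inj_card_eq.
apply: (extend (f @` X)).
- by move=> _ [x /fD[]? _ <-].
- by move=> _ [x /fD[]? ? <-].
- by exists (f x0), x0.
- rewrite (card_le_eqr fX); apply: card_le_trans sX; apply: words_split.
  rewrite -(card_le_eqr fX); apply: subset_card_le => z [[]//].
Qed.

Lemma signed_words_card_le A : infinite_set A -> signed_words A #<= A.
Proof.
move=> Ainf; have /infiniteP/card_le_injP[e eA einj] := Ainf.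
apply: card_le_trans (words_card Ainf).
apply: (@signed_words_card _ (e 0%N) (e 1%N)); try exact: eA.
by move=> /einj; rewrite !inE => /(_ I I).
Qed.

Lemma signed_words_countable A : countable A -> countable (signed_words A).
Proof.
move=> /card_le_injP[f _ finj].
apply: (@card_le_inj _ _ _ _ (fun l => pickle (map (fun p : bool * T => (p.1, f p.2)) l))) => //.
move=> l l' /set_mem Al /set_mem Al' /(pcan_inj pickleK).
elim: l l' Al Al' => [|[s x] l IH] [|[s' x'] l']//= Al Al' [-> e] /IH-> //.
- congr (_ :: _); congr (_, _); apply: finj => //; rewrite inE.
    by apply: (Al (s, x)); rewrite inE eqxx.
  by apply: (Al' (s', x')); rewrite inE eqxx.
- by move=> z zl; apply: Al; rewrite /= inE zl orbT.
- by move=> z zl; apply: Al'; rewrite /= inE zl orbT.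
Qed.

Lemma not_card_le_signed_words (U : Type) (B : set U) A : ~ countable B ->
  ~ (B #<= A) -> ~ (B #<= signed_words A).
Proof.
move=> Bunc BA BsA; have [Afin|Ainf] := pselect (finite_set A).
  by apply: Bunc; apply: card_le_trans BsA _;
    exact/signed_words_countable/finite_set_countable.
by apply: BA; apply: card_le_trans BsA (signed_words_card_le Ainf).
Qed.

End Words.

(** * The cardinal b *)

Lemma nearooP (P : nat -> Prop) :
  (\forall n \near \oo, P n) <-> exists N, forall n, (N <= n)%N -> P n.
Proof. by split=> [[N _ NP]|[N NP]]; exists N. Qed.

Lemma unbounded_uncountable B : unbounded B -> ~ countable B.
Proof.
move=> Bunb /card_le_injP[c _ cinj]; apply: Bunb.
have /choice[h hP] k : exists h, forall f, B f -> c f = k -> f = h.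
  have [[f [Bf fk]]|nf] := pselect (exists f, B f /\ c f = k); last first.
    by exists point => f Bf fk; exfalso; apply: nf; exists f.
  exists f => f' Bf' f'k.
  by apply: cinj; rewrite ?inE // f'k fk.
exists (fun n => \max_(k < n.+1) h k n) => f Bf; apply/nearooP; exists (c f) => n cn.
rewrite (hP _ _ Bf erefl).
exact: (leq_bigmax (F := fun k : 'I_n.+1 => h k n) (Ordinal (cn : (c f < n.+1)%N))).
Qed.

Lemma not_unbounded (B X : set (nat -> nat)) : min_card_witness unbounded B ->
  ~ (B #<= X) -> exists g, forall f, X f -> le_star f g.
Proof. by move=> [_ Bmin] BX; apply: contrapT => Xunb; apply/BX/Bmin. Qed.

(** Well-order the type. If some proper initial segment of [B] is as large as [B], the one below the
    least such point serves as [A]; otherwise [B] does. *)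
Lemma initial_well_order (T : choiceType) (B : set T) :
  exists (R : rel T) (A : set T), [/\ antisymmetric R, A #= B &
    forall x, A x -> ~ (B #<= [set y | A y /\ ~ R x y])].
Proof.
have [R Rwo] := wochoice.well_ordering_principle T; exists R.
have Rrefl x : R x x.
  have [|z [[/eqP zx Rz] _]] := Rwo (pred1 x); first by exists x; exact: eqxx.
  by rewrite -{1}zx; apply: Rz; exact: eqxx.
have Ranti : antisymmetric R.
  move=> x y /andP[Rxy Ryx].
  have [|z [_ zuniq]] := Rwo (pred2 x y); first by exists x; rewrite !inE eqxx.
  suff [<- <-] : z = x /\ z = y by [].
  split; apply: zuniq; split; rewrite ?inE ?eqxx ?orbT //.
    by move=> t; rewrite inE => /orP[]/eqP->.
  by move=> t; rewrite inE => /orP[]/eqP->.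
have [[x Bx]|nx] := pselect (exists x, B #<= [set y | B y /\ ~ R x y]); last first.
  by exists B; split=> // x _ Bx; apply: nx; exists x.
have [|x0 [[/asboolP Bx0 x0min] _]] := Rwo [pred x | `[< B #<= [set y | B y /\ ~ R x y] >]].
  by exists x; exact/asboolP.
exists [set y | B y /\ ~ R x0 y]; split=> //.
  by apply: Cantor_Bernstein => //; apply: subset_card_le => y [].
move=> y [By Ry] H; apply/Ry/x0min/asboolP; apply: card_le_trans H _.
by apply: subset_card_le => z [[]].
Qed.

(** Each [s i] dominates [b i] and all earlier [b j], which are too few to be unbounded. Given [g],
    some [b a] is not dominated by it: [I] is where [b a] exceeds [g], and [X] consists of the
    indices before [a]. *)
Lemma b_scale B : min_card_witness unbounded B ->
  exists (A : set (nat -> nat)) (s : (nat -> nat) -> nat -> nat), A #= B /\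
  forall g, exists (X : set (nat -> nat)) (I : set nat),
    [/\ ~ (B #<= X), forall N, exists2 n, (N <= n)%N & I n &
      forall i, A i -> ~ X i ->
        exists N, forall n, (N <= n)%N -> I n -> (g n < s i n)%N].
Proof.
move=> Bw; have [R [A [Ranti AB Aseg]]] := initial_well_order B.
have [b [_ _ bAB]] := card_set_bijP AB.
have /choice[s sP] i : exists s, A i ->
    le_star (b i) s /\ forall j, A j -> ~ R i j -> le_star (b j) s.
  have [Ai|] := pselect (A i); last by exists point.
  have [|g gP] := @not_unbounded B (b @` [set y | A y /\ ~ R i y]) Bw.
    by move=> /card_le_trans/(_ (card_image_le _ _)); exact: Aseg.
  exists (fun n => maxn (g n) (b i n)) => _; split.
    by apply/nearooP; exists 0%N => n _; rewrite leq_maxr.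
  move=> j Aj Rij; have /nearooP[N NP] : le_star (b j) g by apply: gP; exists j.
  by apply/nearooP; exists N => n /NP /leq_trans; apply; rewrite leq_maxl.
exists A, s; split=> // g.
have [f Bf fg] : exists2 f, B f & ~ le_star f g.
  apply: contrapT => H; apply: Bw.1; exists g => f Bf; apply: contrapT => fg.
  by apply: H; exists f.
have [a Aa af] := bAB _ Bf.
exists [set y | A y /\ ~ R a y], [set n | (g n < b a n)%N]; split; first exact: Aseg.
  move=> N; apply: contrapT => H; apply: fg; apply/nearooP; exists N => n Nn.
  by rewrite leqNgt; apply/negP => gf; apply: H; exists n; rewrite //= af.
move=> i Ai /not_andP[//|/contrapT Rai].
suff /nearooP[N NP] : le_star (b a) (s i).
  by exists N => n /NP bs /= gb; exact: leq_trans gb bs.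
have [si_i si] := sP i Ai.
have [->//|ia] := eqVneq a i.
by apply: si => // Ria; move: ia; rewrite (Ranti a i) ?eqxx// Rai.
Qed.

(** * The cardinal cov(M) *)

Section RealLine.
Variable R : realType.
Implicit Types (a b : R).

Lemma nowhere_dense_itv (S : set R) :
  (forall a b, (a < b)%R -> exists c d : R, [/\ (a <= c)%R, (c < d)%R, (d <= b)%R &
    forall x, (c < x < d)%R -> ~ S x]) -> nowhere_dense S.
Proof.
move=> H; apply/seteqP; split=> // x /nbhs_ballP[e /= e0 xS].
have [|c [d [ac cd db cdS]]] := H (x - e)%R (x + e)%R; first by lra.
have cdm := mid_in_itvoo cd.
have xm : ball x e ((c + d) / 2)%R.
  by move: cdm; rewrite in_itv /= /ball /= ltr_norml => cdm; lra.
have [y [Sy]] := xS _ xm _ (near_in_itvoo cdm).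
by rewrite /= in_itv /= => /cdS.
Qed.

Lemma nowhere_dense_avoid (S : set R) a b : nowhere_dense S -> (a < b)%R ->
  exists c d : R, [/\ (a <= c)%R, (c < d)%R, (d <= b)%R &
    forall x, (c < x < d)%R -> ~ S x].
Proof.
move=> S0 ab.
have [x [xab xS]] : exists x, x \in `]a, b[%R /\ ~ closure S x.
  apply: contrapT => H; have : (closure S)° ((a + b) / 2)%R.
    apply: filterS (near_in_itvoo (mid_in_itvoo ab)) => x xab.
    by apply: contrapT => xS; apply: H; exists x.
  by rewrite S0.
have /existsNP[B /not_implyP[/nbhs_ballP[e /= e0 eB] SB]] := xS.
move: xab; rewrite in_itv /= => /andP[ax xb].
exists (Num.max a (x - e))%R, (Num.min b (x + e))%R; split.
- by rewrite le_max lexx.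
- by rewrite gt_max !lt_min; lra.
- by rewrite ge_min lexx.
- move=> y; rewrite gt_max lt_min => /andP[/andP[ay ey] /andP[yb ye]] Sy.
  apply: SB; exists y; split=> //; apply: eB.
  by rewrite /ball /= ltr_norml; lra.
Qed.

(* On each interval [[m / n, (m + 1) / n)] with [m] an integer, [digit n] takes every
   value on a nondegenerate subinterval. *)
Definition digit (n : nat) (x : R) : nat :=
  (Num.trunc (n%:R * x - (Num.floor (n%:R * x))%:~R)^-1%R).-1.

Lemma digit_itv a b : (a < b)%R -> exists N, forall n, (N <= n)%N -> forall v,
  exists c d : R, [/\ (a <= c)%R, (c < d)%R, (d <= b)%R &
    forall x, (c < x < d)%R -> digit n x = v].
Proof.
move=> ab; have ba2 : (0 < (b - a) / 2)%R by lra.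
have [N] := ltr_add_invr ba2; rewrite add0r => aN; exists N.+1 => n Nn v.
have n0 : (0 < n%:R :> R)%R by rewrite ltr0n (leq_trans _ Nn).
have nab : (2 < n%:R * (b - a))%R.
  suff : (1 < n%:R * ((b - a) / 2))%R by lra.
  apply: le_lt_trans (_ : n%:R * N.+1%:R^-1 < _)%R; last by rewrite ltr_pM2l.
  by rewrite ler_pdivlMr ?ltr0n // mul1r ler_nat.
(* [m / n] is the first grid point beyond [a]; the next one is still below [b] by [nab]. *)
pose m := (Num.floor (n%:R * a) + 1)%R.
have /andP[ma am] := floor_itv (n%:R * a)%R.
have {}ma : (m%:~R <= n%:R * a + 1)%R by rewrite intrD lerD2r.
rewrite -/m in am.
have v1 : ((v.+1%:R : R)^-1 <= 1)%R by rewrite invf_le1 ?ltr0n // ler1n.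
have v2 : (0 < (v.+2%:R : R)^-1)%R by rewrite invr_gt0 ltr0n.
have v12 : ((v.+2%:R : R)^-1 < (v.+1%:R : R)^-1)%R.
  by rewrite ltf_pV2 ?posrE ?ltr0n // ltr_nat.
have [p pE] : exists p : R, p = (v.+1%:R^-1)%R by eexists.
have [q qE] : exists q : R, q = (v.+2%:R^-1)%R by eexists.
have [k kE] : exists k : R, k = m%:~R%R by eexists.
rewrite -?pE -?qE -?kE in v1 v2 v12 am ma.
(* If the fractional part of [n x] lies between [1 / (v + 2)] and [1 / (v + 1)], its reciprocal
   truncates to [v + 1], one more than the digit. *)
exists ((k + q) / n%:R)%R, ((k + p) / n%:R)%R; split.
- by rewrite ler_pdivlMr // mulrC; lra.
- by rewrite ltr_pM2r ?invr_gt0 //; lra.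
- by rewrite ler_pdivrMr // [(b * _)%R]mulrC; lra.
- move=> x; rewrite ltr_pdivrMr // ltr_pdivlMr // mulrC => /andP[mx xm].
  rewrite /digit (@floor_def _ _ m) -?kE; last by rewrite intrD -kE; lra.
  suff -> : Num.trunc (n%:R * x - k)^-1%R = v.+1 by [].
  apply: truncn_def; rewrite -[v.+1%:R%R]invrK -[v.+2%:R%R]invrK -pE -qE.
  by rewrite lef_pV2 ?ltf_pV2 ?posrE; lra.
Qed.

(** The reals whose digits miss [phi h] at all [n >= N] in [I] form a nowhere dense set. If the
    digits of no real made all the guesses, these sets would yield a meager cover no larger than
    [H]. *)
Lemma small_family_guess (C : set (set R)) T (H : set T) (phi : T -> nat -> nat)
    (I : set nat) :
  min_card_witness (@meager_cover R) C -> ~ (C #<= H) ->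
  (forall N, exists2 n, (N <= n)%N & I n) ->
  exists f, forall h, H h -> forall N, exists n, [/\ (N <= n)%N, I n & f n = phi h n].
Proof.
move=> Cw CH Iinf; apply: contrapT => nof.
pose S h N := [set x : R | forall n, (N <= n)%N -> I n -> digit n x <> phi h n].
apply: CH; apply: card_le_trans (card_image_le (fun h => \bigcup_N S h N) H).
apply: Cw.2; split.
  move=> _ [h Hh <-]; exists (S h) => // N; apply: nowhere_dense_itv => a b ab.
  have [M MP] := digit_itv ab; have [n + In] := Iinf (maxn N M).
  rewrite geq_max => /andP[Nn /MP/(_ (phi h n))[c [d [ac cd db cdP]]]].
  by exists c, d; split=> // x /cdP xh /(_ n Nn In).
apply/seteqP; split=> // x _; apply: contrapT => nx.
apply: nof; exists (digit ^~ x) => h Hh N; apply: contrapT => nn; apply: nx.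
exists (\bigcup_N S h N); first by exists h.
by exists N => // n Nn In xn; apply: nn; exists n.
Qed.

End RealLine.

(** * From a small meager cover to a family that no sequence guesses *)

Lemma bounded_choice (P : nat -> nat -> Prop) : (forall k, exists c, P k c) ->
  forall j, exists K, forall k, (k <= j)%N -> exists2 c, (c <= K)%N & P k c.
Proof.
move=> /choice[c cP] j; exists (\max_(k < j.+1) c k) => k kj; exists (c k) => //.
exact: (leq_bigmax (F := fun k : 'I_j.+1 => c k) (Ordinal (kj : (k < j.+1)%N))).
Qed.

Lemma unbounded_uniq_seq (I : set nat) : (forall N, exists2 n, (N <= n)%N & I n) ->
  forall N m, exists s : seq nat,
    [/\ size s = m, uniq s & forall d, d \in s -> (N <= d)%N /\ I d].
Proof.
move=> Iinf N; elim=> [|m [s [sm us sP]]]; first by exists [::].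
have [d + Id] := Iinf (maxn N (\max_(e <- s) e).+1).
rewrite geq_max => /andP[Nd sd]; exists (d :: s); split=> /=.
- by rewrite sm.
- rewrite us andbT; apply: contraTN sd => ds.
  by rewrite -leqNgt (big_rem d)//= leq_maxl.
- by move=> e; rewrite inE => /orP[/eqP->|/sP].
Qed.

(* With [g] not dominated by any [h o h], [h] a modulus for [P a], the sequence
   [J (d + 1) = max(J d + 1, g (J d))] works: if [g n > h (h n)] and
   [J d <= n < J (d + 1)], then either [h n <= J (d + 1)] or [h (h n) <= J (d + 2)]. *)
Lemma undominated_partition T (C : set T) (D : set (nat -> nat))
    (P : T -> nat -> nat -> Prop) :
  min_card_witness dominating D -> ~ (D #<= C) ->
  (forall a j K j' K', P a j K -> (j' <= j)%N -> (K <= K')%N -> P a j' K') ->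
  (forall a, C a -> forall j, exists K, P a j K) ->
  exists J : nat -> nat, (forall d, (J d < J d.+1)%N) /\
    forall a, C a -> forall N, exists2 d, (N <= d)%N & P a (J d) (J d.+1).
Proof.
move=> Dw DC Pmono Pex.
have /choice[h hP] a : exists h, C a -> forall j, P a j (h j).
  have [Ca|] := pselect (C a); last by exists id.
  by have /choice[h hP] := Pex a Ca; exists h.
have [g gP] : exists g, forall a, C a -> ~ le_star g (h a \o h a).
  apply: contrapT => H; apply: DC.
  apply: card_le_trans (card_image_le (fun a => h a \o h a) C).
  apply: Dw.2 => g; apply: contrapT => H'; apply: H; exists g => a Ca ga.
  by apply: H'; exists (h a \o h a) => //; exists a.
pose G n := \max_(k < n.+1) g k.
have gG k n : (k <= n)%N -> (g k <= G n)%N.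
  by move=> kn; exact: (leq_bigmax (F := fun k : 'I_n.+1 => g k)
    (Ordinal (kn : (k < n.+1)%N))).
pose J d := iter d (fun j => maxn j.+1 (G j)) 0%N.
have Jlt d : (J d < J d.+1)%N by rewrite /J iterS leq_max leqnn.
have Jge d : (d <= J d)%N by elim: d => // d IH; exact: leq_ltn_trans IH (Jlt d).
exists J; split=> // a Ca N.
have [n [Nn gn]] : exists n, (J N <= n)%N /\ (h a (h a n) < g n)%N.
  apply: contrapT => H; apply: (gP a Ca); apply/nearooP; exists (J N) => n Nn.
  by rewrite leqNgt; apply/negP => gn; apply: H; exists n.
have [d [Nd dn nd]] : exists d, [/\ (N <= d)%N, (J d <= n)%N & (n < J d.+1)%N].
  have exd : exists d, (n < J d.+1)%N by exists n; exact: Jge.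
  exists (ex_minn exd); case: ex_minnP => d nd dmin; split=> //.
    rewrite leqNgt; apply/negP => dN.
    have /(_ _ _ dN) JdN : {homo J : x y / (x <= y)%N}.
      by apply: homo_leq => //; [exact: leq_trans|move=> i; exact: ltnW].
    by have := leq_trans nd (leq_trans JdN Nn); rewrite ltnn.
  case: d nd dmin => [|d] nd dmin //.
  by rewrite leqNgt; apply/negP => /dmin; rewrite ltnn.
have [hd|hd] := leqP (h a n) (J d.+1).
  by exists d => //; exact: Pmono (hP a Ca n) dn hd.
exists d.+1; first exact: leqW.
apply: Pmono (hP a Ca (h a n)) (ltnW hd) _.
rewrite [J d.+2]/J iterS -/(J d.+1) leq_max; apply/orP; right.
exact: leq_trans (ltnW gn) (gG _ _ (ltnW nd)).
Qed.

Section NoGuess.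
Variable R : realType.

(** Naturals code the intervals [[q, q + 1 / (m + 1)]] with [q] rational; a number coding no pair
    stands for [[0, 1]]. *)
Definition basic_lo (k : nat) : R := ratr (odflt (0%R, 0%N) (unpickle k : option (rat * nat))).1.
Definition basic_hi (k : nat) : R :=
  (basic_lo k + (odflt (0%R, 0%N) (unpickle k : option (rat * nat))).2.+1%:R^-1)%R.

Definition basic (k : nat) (x : R) := (basic_lo k <= x <= basic_hi k)%R.
Definition sub_basic (k' k : nat) :=
  (basic_lo k <= basic_lo k')%R && (basic_hi k' <= basic_hi k)%R.

Lemma basic_lt k : (basic_lo k < basic_hi k)%R.
Proof. by rewrite ltrDl invr_gt0 ltr0n. Qed.

Lemma basic_between (a b : R) : (a < b)%R ->
  exists k, (a < basic_lo k)%R /\ (basic_hi k < b)%R.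
Proof.
move=> ab; have [q] := rat_in_itvoo ab; rewrite in_itv /= => /andP[aq qb].
have [m qm] := ltr_add_invr qb.
by exists (pickle (q, m)); rewrite /basic_hi /basic_lo pickleK.
Qed.

Lemma sub_basic_trans k1 k2 k3 : sub_basic k1 k2 -> sub_basic k2 k3 -> sub_basic k1 k3.
Proof.
move=> /andP[l12 h12] /andP[l23 h23].
by rewrite /sub_basic (le_trans l23 l12) (le_trans h12 h23).
Qed.

Lemma sub_basicP k k' x : sub_basic k' k -> basic k' x -> basic k x.
Proof.
move=> /andP[l h] /andP[l' h']; apply/andP.
by split; [exact: le_trans l l'|exact: le_trans h' h].
Qed.

Lemma basic_avoid (N : nat -> set R) : (forall n, nowhere_dense (N n)) ->
  forall j k, exists k', sub_basic k' k /\
    forall n, (n <= j)%N -> forall x, basic k' x -> ~ N n x.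
Proof.
move=> N0.
have avoid n k : exists k', sub_basic k' k /\ forall x, basic k' x -> ~ N n x.
  have [c [d [ac cd db cdN]]] := nowhere_dense_avoid (N0 n) (basic_lt k).
  have [k' [ck kd]] := basic_between cd; exists k'.
  split=> [|x /andP[lx xh]].
    by rewrite /sub_basic (le_trans ac (ltW ck)) (le_trans (ltW kd) db).
  by apply: cdN; rewrite (lt_le_trans ck lx) (le_lt_trans xh kd).
elim=> [|j IH] k.
  by have [k' [k'k k'N]] := avoid 0%N k; exists k'; split=> // n;
    rewrite leqn0 => /eqP->.
have [k1 [k1k k1N]] := IH k; have [k2 [k2k1 k2N]] := avoid j.+1 k1.
exists k2; split=> [|n]; first exact: sub_basic_trans k2k1 k1k.
rewrite leq_eqVlt => /predU1P[->|nj] x k2x; first exact: k2N.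
exact: k1N nj _ (sub_basicP k2k1 k2x).
Qed.

Lemma basic_nested (k : nat -> nat) : (forall d, sub_basic (k d.+1) (k d)) ->
  exists z, forall d, basic (k d) z.
Proof.
move=> kS.
have kmono d e : (d <= e)%N -> sub_basic (k e) (k d).
  move=> /subnK<-; elim: (e - d)%N => [|i IH]; first by rewrite /sub_basic !lexx.
  by rewrite addSn; exact: sub_basic_trans (kS _) IH.
have lohi d e : (basic_lo (k e) <= basic_hi (k d))%R.
  have /andP[l _] := kmono _ _ (leq_maxr d e).
  have /andP[_ h] := kmono _ _ (leq_maxl d e).
  exact: le_trans l (le_trans (ltW (basic_lt _)) h).
pose E := range (fun d => basic_lo (k d)).
have Eub d : ubound E (basic_hi (k d)) by move=> _ [e _ <-].
exists (sup E) => d; apply/andP; split.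
  by apply: ub_le_sup; [exists (basic_hi (k 0%N))|exists d].
by apply: ge_sup => //; exists (basic_lo (k 0%N)), 0%N.
Qed.

(* Bartoszynski's argument: [y A n] lists [n + 1] blocks [[J d, J (d + 1)]] together
   with moves, for each basic interval with index at most [J d], into a basic interval
   with index at most [J (d + 1)] avoiding the first nowhere dense pieces of [A].  From
   [f] equal to [y A n] for infinitely many [n], using for each [n] the moves of a block
   listed by [f n] and not used before leads to a point outside [A]. *)
Lemma no_guessing (C : set (set R)) (D : set (nat -> nat)) :
  meager_cover C -> min_card_witness dominating D -> ~ (D #<= C) ->
  exists y : set R -> nat -> nat, forall f : nat -> nat,
    exists2 A, C A & exists N, forall n, (N <= n)%N -> f n <> y A n.
Proof.
move=> [Cm Ccov] Dw DC.
have /choice[N NP] A : exists N : nat -> set R, C A ->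
    (forall n, nowhere_dense (N n)) /\ A = \bigcup_n N n.
  have [CA|] := pselect (C A); last by exists (fun=> set0).
  by have [N N0 AN] := Cm A CA; exists N.
pose P A j K := forall k, (k <= j)%N -> exists2 c, (c <= K)%N &
  sub_basic c k /\ forall n, (n <= j)%N -> forall x, basic c x -> ~ N A n x.
have [||J [Jlt JP]] := @undominated_partition _ C D P Dw DC.
- move=> A j K j' K' PA j'j KK' k kj'.
  have [c cK [ck cN]] := PA k (leq_trans kj' j'j).
  exists c; first exact: leq_trans cK KK'.
  by split=> // n nj'; apply: cN; exact: leq_trans nj' j'j.
- move=> A CA j; exact: (@bounded_choice (fun k c => sub_basic c k /\
    forall n, (n <= j)%N -> forall x, basic c x -> ~ N A n x)
    (basic_avoid (NP A CA).1 j) j).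
have Jge d : (d <= J d)%N by elim: d => // d IH; exact: leq_ltn_trans IH (Jlt d).
have /choice[sg sgP] (Ad : set R * nat) : exists s : nat -> nat,
    P Ad.1 (J Ad.2) (J Ad.2.+1) -> forall k, (k <= J Ad.2)%N -> (s k <= J Ad.2.+1)%N /\
      (sub_basic (s k) k /\
       forall n, (n <= J Ad.2)%N -> forall x, basic (s k) x -> ~ N Ad.1 n x).
  case: Ad => A d /=.
  have [PA|] := pselect (P A (J d) (J d.+1)); last by exists id.
  have /choice[s sP] k : exists c, (k <= J d)%N -> (c <= J d.+1)%N /\ (sub_basic c k /\
      forall n, (n <= J d)%N -> forall x, basic c x -> ~ N A n x).
    have [kJ|] := leqP k (J d); last by exists 0%N.
    by have [c cJ cP] := PA k kJ; exists c.
  by exists s => _.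
have /choice[ds dsP] A : exists ds : nat -> seq nat, C A -> forall n,
    [/\ size (ds n) = n.+1, uniq (ds n) &
      forall d, d \in ds n -> (n <= d)%N /\ P A (J d) (J d.+1)].
  have [CA|] := pselect (C A); last by exists (fun=> [::]).
  have /choice[ds dsP] n := unbounded_uniq_seq (JP A CA) n n.+1.
  by exists ds.
pose block A d := (d, mkseq (sg (A, d)) (J d).+1).
exists (fun A n => pickle [seq block A d | d <- ds A n]) => f.
pose dec n : seq (nat * seq nat) := odflt [::] (unpickle (f n)).
pose pick (used : seq (nat * seq nat)) n :=
  [seq p <- dec n | p.1 \notin map fst used].
pose fix used n := if n is m.+1 then
  (if pick (used m) m is p :: _ then p :: used m else used m) else [::].
have used_size n : (size (used n) <= n)%N.
  by elim: n => //= n IH; case: (pick _ _) => [|p s] //=; exact: leqW.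
have used_uniq n : uniq (map fst (used n)).
  elim: n => //= n IH; case E: (pick _ _) => [|p s] //=.
  have : p \in pick (used n) n by rewrite E mem_head.
  by rewrite mem_filter => /andP[-> _].
have used_mono m n : (m <= n)%N -> {subset used m <= used n}.
  move=> /subnK<-; elim: (n - m)%N => // i IH p /IH; rewrite addSn /=.
  by case: (pick _ _) => //= q s; rewrite inE orbC => ->.
have used_fun m n p q : p \in used m -> q \in used n -> p.1 = q.1 -> p = q.
  move=> /(used_mono _ _ (leq_maxl m n)) pU /(used_mono _ _ (leq_maxr m n)) qU pq.
  elim: (used _) (used_uniq (maxn m n)) pU qU => //= r s IH /andP[rs us].
  rewrite !inE => /predU1P[pr|ps] /predU1P[qr|qs]; last exact: IH.
  - by rewrite pr qr.
  - by move: rs => /negP[]; rewrite -pr pq; exact: map_f.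
  - by move: rs => /negP[]; rewrite -qr -pq; exact: map_f.
(* The moves recorded with block [d], unambiguous because no block is used twice. *)
have /choice[tau tauP] d : exists t, forall n p, p \in used n -> p.1 = d -> p.2 = t.
  have [[n [p [pn pd]]]|no] := pselect (exists n p, p \in used n /\ p.1 = d).
    exists p.2 => m q qm qd; rewrite (used_fun _ _ _ _ qm pn) //.
    by rewrite qd pd.
  by exists [::] => n p pn pd; exfalso; apply: no; exists n, p.
(* A move is followed only if legal, so for every [f] the intervals are nested and [k d <= J d]. *)
pose next d k := let c := nth 0%N (tau d) k in
  if sub_basic c k && (c <= J d.+1)%N then c else k.
pose fix k d := if d is e.+1 then next e (k e) else 0%N.
have kJ d : (k d <= J d)%N.
  elim: d => //= d IH; rewrite /next; case: ifP => [/andP[]//|_].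
  exact: leq_trans IH (ltnW (Jlt d)).
have kS d : sub_basic (k d.+1) (k d).
  rewrite /= /next; case: ifP => [/andP[]//|_].
  by rewrite /sub_basic !lexx.
have [z zk] := basic_nested kS.
have [A CA Az] : (\bigcup_(A in C) A) z by rewrite Ccov.
exists A => //; apply: contrapT => H.
have [_ AN] := NP A CA; move: Az; rewrite {1}AN => -[m _ mz].
have [n mn fn] : exists2 n, (m <= n)%N & f n = pickle [seq block A d | d <- ds A n].
  apply: contrapT => H'; apply: H; exists m => n mn fn.
  by apply: H'; exists n.
have [dsn dsu dsPn] := dsP A CA n.
have decn : dec n = [seq block A d | d <- ds A n] by rewrite /dec fn pickleK.
(* The [n + 1] blocks listed for [A] cannot all be among the at most [n] used ones. *)
have [d dd du] : exists2 d, d \in ds A n & block A d \in used n.+1.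
  have : has predT (pick (used n) n).
    rewrite has_predT lt0n; apply/eqP => /size0nil E.
    have : (size (ds A n) <= size (map fst (used n)))%N.
      apply: uniq_leq_size => // d dd; apply: contrapT => /negP du.
      have : block A d \in pick (used n) n.
        by rewrite mem_filter du decn map_f.
      by rewrite E.
    by rewrite dsn size_map ltnNge used_size.
  rewrite /=; case E: (pick _ _) => [|p s] //= _.
  have : p \in pick (used n) n by rewrite E mem_head.
  rewrite mem_filter decn => /andP[_ /mapP[d dd pd]].
  by exists d => //; rewrite pd mem_head.
have [nd PAd] := dsPn d dd.
have td : tau d = mkseq (sg (A, d)) (J d).+1 by rewrite -(tauP d _ _ du).
have [sJ [sk sN]] := sgP (A, d) PAd (k d) (kJ d).
have kd : k d.+1 = sg (A, d) (k d).
  by rewrite /= /next td nth_mkseq ?ltnS // sk sJ.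
(* As [m <= n <= d <= J d], the piece [N A m] containing [z] is avoided by the move at block [d]. *)
apply: (sN m _ z) => //; last by rewrite -kd.
exact: leq_trans mn (leq_trans nd (Jge d)).
Qed.

End NoGuess.

(** * The group generated by the branches *)

Lemma ZN_nbhs_agree (f : ZN) (U : set ZN) : nbhs f U ->
  exists m, forall g : ZN, (forall i, (i < m)%N -> g i = f i) -> U g.
Proof.
pose F : set_system ZN := filter_from setT
  (fun m => [set g : ZN | forall i, (i < m)%N -> g i = f i]).
have FF : Filter F.
  apply: filter_from_filter; first by exists 0%N.
  move=> m n _ _; exists (maxn m n) => // g gP; split=> i im; apply: gP.
    by rewrite leq_max im.
  by rewrite leq_max im orbT.
have /(_ U) cF : F --> f.
  apply: ZN_cvg => i A /nbhs_singleton Afi; exists i.+1 => // g /(_ i (ltnSn i)) /= ->.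
  exact: Afi.
by move=> /cF [m _ mU]; exists m.
Qed.

Definition coords (G : zmodClosed ZN) (g : subgroup G) : nat -> int := (val g : ZN).

Section SubgroupTopology.
Variable G : zmodClosed ZN.
Implicit Types g h : subgroup G.

Lemma subgroup_nbhs_agree g (U : set (subgroup G)) : nbhs g U ->
  exists m, forall h, (forall i, (i < m)%N -> coords h i = coords g i) -> U h.
Proof.
move=> [_ [[V oV <-] Vg VU]].
have [m mV] := ZN_nbhs_agree (open_nbhs_nbhs (conj oV Vg)).
by exists m => h /mV/VU.
Qed.

Lemma subgroup_agree_nbhs g m :
  nbhs g [set h | forall i, (i < m)%N -> coords h i = coords g i].
Proof.
elim: m => [|m IH]; first by apply: filterS filterT => h _ i.
have : nbhs g [set h | coords h m = coords g m].
  exact: (@subgroup_val_continuous _ G g) (ZN_nbhs_proj (val g) m).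
apply: filterS2 IH => h hg hm i; rewrite ltnS leq_eqVlt => /predU1P[->//|].
exact: hg.
Qed.

Lemma subgroup_open_coord (m : nat) (P : (nat -> int) -> Prop) :
  (forall x y : nat -> int, (forall i, (i < m)%N -> x i = y i) -> P x -> P y) ->
  open [set g : subgroup G | P (coords g)].
Proof.
move=> mP; rewrite openE => g Pg; apply: filterS (subgroup_agree_nbhs g m) => h hg.
by apply: mP Pg => i /hg.
Qed.

End SubgroupTopology.

(* The characteristic function of the set of codes of the initial segments of [w]. *)
Definition branch (w : nat -> nat * nat) (m : nat) : int :=
  if pickle_inv m is Some t then (t == mkseq w (size t))%:R%R else 0%R.

Lemma branch_pickle w t : branch w (pickle t) = (t == mkseq w (size t))%:R%R.
Proof. by rewrite /branch pickleK_inv. Qed.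

Section BranchGroup.
Variables (T : pointedType) (w : T -> nat -> nat * nat) (A : set T).
Implicit Types l : seq (bool * T).
Local Open Scope ring_scope.

(** Integer coefficients arise by repeating signed letters, so the group is an image of a set of
    words, whose size is under control. *)
Definition comb l : ZN := fun m => \sum_(p <- l) (-1) ^+ p.1 * branch (w p.2) m.

Lemma comb_cat l1 l2 m : comb (l1 ++ l2) m = comb l1 m + comb l2 m.
Proof. exact: big_cat. Qed.

Lemma comb_opp l m : comb [seq (~~ p.1, p.2) | p <- l] m = - comb l m.
Proof.
rewrite /comb big_map -sumrN; apply: eq_bigr => p _ /=.
by rewrite signrN mulNr.
Qed.

Lemma comb_norm_le l m : `|comb l m| <= (size l)%:R.
Proof.
rewrite /comb; apply: le_trans (ler_norm_sum _ _ _) _.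
rewrite -sum1_size natr_sum; apply: ler_sum => p _.
rewrite normrMsign /branch; case: pickle_inv => [t|]; last by rewrite normr0.
by rewrite normr_nat ler_nat leq_b1.
Qed.

Lemma comb_level l n : comb l (pickle ([::] : seq (nat * nat))) != 0 ->
  exists t : seq (nat * nat), size t = n /\ comb l (pickle t) != 0.
Proof.
move=> l0; apply: contrapT => H; move: l0.
(* [undup] counts a node shared by several branches only once. *)
pose ts := undup [seq mkseq (w p.2) n | p <- l].
have -> : comb l (pickle ([::] : seq (nat * nat))) = \sum_(t <- ts) comb l (pickle t).
  rewrite /comb exchange_big /=; apply: eq_big_seq => p pl.
  rewrite -mulr_sumr; congr (_ * _); rewrite branch_pickle eqxx.
  rewrite (bigD1_seq (mkseq (w p.2) n)) ?undup_uniq ?mem_undup //=; last by apply/mapP; exists p.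
  rewrite branch_pickle size_mkseq eqxx big1_seq ?addr0 // => t /andP[tp].
  rewrite mem_undup branch_pickle => /mapP[q _ tq].
  by move: tp; rewrite {3}tq size_mkseq => /negbTE ->.
rewrite big1_seq ?eqxx // => t /andP[_]; rewrite mem_undup => /mapP[q _ tq].
apply/eqP; apply: contrapT => /negP t0; apply: H; exists t.
by split=> //; rewrite tq size_mkseq.
Qed.

Definition comb_group : {pred ZN} :=
  fun g => `[< exists2 l, signed_words A l & g = comb l >].

Lemma comb_group_zmod_closed : zmod_closed comb_group.
Proof.
split; first by apply/asboolP; exists [::] => //; apply/funext => m; rewrite /comb big_nil.
move=> _ _ /asboolP[l Al ->] /asboolP[l' Al' ->].
apply/asboolP; exists (l ++ [seq (~~ p.1, p.2) | p <- l']).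
  by move=> p; rewrite mem_cat => /orP[/Al//|/mapP[q /Al' qA ->]].
by apply/funext => m; rewrite comb_cat comb_opp.
Qed.

HB.instance Definition _ := GRing.isZmodClosed.Build ZN comb_group comb_group_zmod_closed.

Lemma comb_groupP (g : subgroup comb_group) :
  exists2 l, signed_words A l & coords g = comb l.
Proof. by have /asboolP := valP g. Qed.

Lemma comb_group_mem l : signed_words A l -> comb l \in comb_group.
Proof. by move=> Al; apply/asboolP; exists l. Qed.

End BranchGroup.

(** * Finite sets and gaps *)

Lemma finite_nat_bound (F : set nat) : finite_set F -> exists K, forall n, F n -> (n <= K)%N.
Proof.
move=> /finite_seqP[s ->]; exists (\max_(n <- s) n) => n /= ns.
by rewrite (big_rem n)//= leq_maxl.
Qed.

Definition box (p n : nat) : set (seq int) :=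
  [set q : seq int | size q = p /\ forall v, v \in q -> (`|v| <= n%:R)%R].

Lemma finite_box p n : finite_set (box p n).
Proof.
have fv : finite_set [set v : int | (`|v| <= n%:R)%R].
  apply: (@sub_finite_set _ _ ((fun k : nat => k%:Z - n%:Z)%R @` `I_(n + n).+1)).
    move=> v /= vn; exists (absz (v + n%:Z)%R); first by rewrite /=; lia.
    by lia.
  exact/finite_image/finite_II.
elim: p => [|p IH].
  by apply: sub_finite_set (finite_set1 [::]) => q [/size0nil->].
apply: sub_finite_set (finite_image2 cons fv IH) => -[|v q] [//= [qp] vn].
exists v; first by apply: vn; exact: mem_head.
by exists q => //; split=> // u uq; apply: vn; rewrite inE uq orbT.
Qed.

Lemma seq_eventually (X : eqType) (P : X -> nat -> Prop) (s : seq X) :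
  (forall x, x \in s -> exists N, forall n, (N <= n)%N -> P x n) ->
  exists N, forall n, (N <= n)%N -> forall x, x \in s -> P x n.
Proof.
elim: s => [|x s IH] sP; first by exists 0%N.
have [|N NP] := IH; first by move=> y ys; apply: sP; rewrite inE ys orbT.
have [M MP] := sP x (mem_head _ _); exists (maxn M N) => n.
rewrite geq_max => /andP[/MP Mn /NP Nn] y; rewrite inE => /predU1P[->//|].
exact: Nn.
Qed.

(** Pigeonhole: [size S + 1] disjoint intervals cannot each contain an element of [S]. *)
Lemma gap (p : nat -> nat) (S : seq nat) : {homo p : k l / (k <= l)%N} ->
  exists2 k, (k <= size S)%N & forall s, s \in S -> ~ (p k <= s < p k.+1)%N.
Proof.
move=> pmono; apply: contrapT => H.
have /choice[c cP] k : exists c, (k <= size S)%N -> c \in S /\ (p k <= c < p k.+1)%N.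
  have [kS|] := leqP k (size S); last by exists 0%N.
  apply: contrapT => H'; apply: H; exists k => // s sS ps; apply: H'.
  by exists s.
have clt k l : (k < l)%N -> (l <= size S)%N -> (c k < c l)%N.
  move=> kl lS; have [_ /andP[_ ck]] := cP k (leq_trans (ltnW kl) lS).
  have [_ /andP[+ _]] := cP l lS; apply: leq_trans; exact: leq_trans ck (pmono _ _ kl).
have : (size [seq c k | k <- iota 0 (size S).+1] <= size S)%N.
  apply: uniq_leq_size.
    rewrite map_inj_in_uniq ?iota_uniq // => k l.
    rewrite !mem_iota !leq0n !ltnS /= => kS lS ckl.
    case: (ltngtP k l) => // kl.
      by have := clt _ _ kl lS; rewrite ckl ltnn.
    by have := clt _ _ kl kS; rewrite ckl ltnn.
  by move=> _ /mapP[k + ->]; rewrite mem_iota leq0n ltnS => /cP[].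
by rewrite size_map size_iota ltnn.
Qed.

Lemma Hurewicz_bounded_Menger (G : topologicalZmodType) :
  Hurewicz_bounded G -> Menger_bounded G.
Proof.
move=> HG U /HG[F [Ffin FU]]; exists F; split=> //.
apply/seteqP; split=> // g _; have /nearooP[N NP] := FU g.
by exists N => //; exact: NP.
Qed.

(** * Boundedness and covering properties in terms of coordinates *)

Section SubgroupCoords.
Variable G : zmodClosed ZN.
Implicit Types g h : subgroup G.
Local Open Scope ring_scope.

Lemma coordsB g h i : coords (g - h) i = coords g i - coords h i.
Proof. by []. Qed.

Lemma subgroup_nbhs0 (U : set (subgroup G)) : nbhs (0 : subgroup G) U ->
  exists m, forall g h, (forall i, (i < m)%N -> coords g i = coords h i) -> U (g - h).
Proof.
move=> /subgroup_nbhs_agree[m mU]; exists m => g h gh; apply: mU => i im.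
by rewrite coordsB gh // subrr.
Qed.

(** Once [n] reaches the bound of [g], the first [m n] coordinates of [g] lie in a finite box; one
    group element represents each tuple. *)
Lemma Hurewicz_bounded_coords :
  (forall g, exists c : nat, forall i, `|coords g i| <= c%:R) ->
  Hurewicz_bounded (subgroup G).
Proof.
move=> Gbnd U U0.
have /choice[m mU] n := subgroup_nbhs0 (U0 n).
have /choice[rep repP] (nq : nat * seq int) : exists a : subgroup G,
    forall g, mkseq (coords g) (m nq.1) = nq.2 -> mkseq (coords a) (m nq.1) = nq.2.
  have [[g gq]|no] := pselect (exists g, mkseq (coords g) (m nq.1) = nq.2).
    by exists g.
  by exists 0 => g gq; exfalso; apply: no; exists g.
exists (fun n => (fun q => rep (n, q)) @` box (m n) n); split.
  by move=> n; exact/finite_image/finite_box.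
move=> g; have [c cg] := Gbnd g; apply/nearooP; exists c => n cn.
pose q := mkseq (coords g) (m n).
exists (rep (n, q)).
  exists q => //; split; first by rewrite size_mkseq.
  move=> _ /mapP[i _ ->]; apply: le_trans (cg i) _.
  by rewrite ler_nat.
exists (g - rep (n, q)); last by rewrite addrC subrK.
apply: mU => i im; have /= := repP (n, q) g erefl.
by move=> /(congr1 (fun s => nth 0 s i)); rewrite !nth_mkseq.
Qed.

(** The guesses [a j] need not come from the group; one that matches a group element on the relevant
    coordinates is replaced by such an element. *)
Lemma Rothberger_bounded_coords :
  (forall m : nat -> nat, exists a : nat -> nat -> int, forall g, exists j,
    forall i, (i < m j)%N -> coords g i = a j i) ->
  Rothberger_bounded (subgroup G).
Proof.
move=> GR U U0.
have /choice[m mU] n := subgroup_nbhs0 (U0 n).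
have [a aP] := GR m.
have /choice[b bP] j : exists b : subgroup G, forall g,
    (forall i, (i < m j)%N -> coords g i = a j i) ->
    forall i, (i < m j)%N -> coords b i = a j i.
  have [[g ga]|no] := pselect (exists g, forall i, (i < m j)%N -> coords g i = a j i).
    by exists g.
  by exists 0 => g ga; exfalso; apply: no; exists g.
exists b; apply/seteqP; split=> // g _; have [j ja] := aP g.
exists j => //; exists (g - b j); last by rewrite addrC subrK.
by apply: mU => i im; rewrite ja // (bP j g).
Qed.

(** For [x] in the group, [phi x n] codes a cylinder around [x] inside a member of the [n]-th cover.
    Some [f] exceeds each [phi x] somewhere, so the codes up to [f n] suffice. *)
Lemma Menger_coords :
  (forall phi : (nat -> int) -> nat -> nat, exists f,
    forall g, ~ le_star f (phi (coords g))) ->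
  Menger (subgroup G).
Proof.
move=> Gd U Ucov.
pose cyl (e : nat) : set (subgroup G) :=
  let t : seq int := odflt [::] (unpickle e) in [set h | mkseq (coords h) (size t) = t].
pose good n e V := U n V /\ cyl e `<=` V.
have /choice[phi phiP] (x : nat -> int) : exists phi : nat -> nat, forall g,
    coords g = x -> forall n, cyl (phi n) g /\ exists V, good n (phi n) V.
  have [[g gx]|no] := pselect (exists g, coords g = x); last first.
    by exists id => g gx; exfalso; apply: no; exists g.
  have /choice[phi phiP] n : exists e, cyl e g /\ exists V, good n e V.
    have [Uo Ug] := Ucov n; have [V UV Vg] : (\bigcup_(V in U n) V) g by rewrite Ug.
    have [m mV] := subgroup_nbhs_agree (open_nbhs_nbhs (conj (Uo V UV) Vg)).
    exists (pickle (mkseq (coords g) m)); rewrite /good /cyl pickleK /= size_mkseq.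
    split=> //; exists V; split=> // h /= hg; apply: mV => i im.
    by have := congr1 (fun s => nth 0 s i) hg; rewrite !nth_mkseq.
  exists phi => h hx n; have [pg gV] := phiP n; split=> //.
  by move: pg; rewrite /cyl /= gx hx.
have [f fP] := Gd phi.
have /choice[V VP] (ne : nat * nat) : exists V, (exists W, good ne.1 ne.2 W) -> good ne.1 ne.2 V.
  have [[W gW]|no] := pselect (exists W, good ne.1 ne.2 W); first by exists W.
  by exists set0 => gW; exfalso; apply: no.
exists (fun n => (fun e => V (n, e)) @` [set e | (e <= f n)%N /\ exists W, good n e W]).
split=> [n|].
  split; last by move=> _ [e [_ /(VP (n, e))[UV _]] <-].
  apply/finite_image/(sub_finite_set _ (finite_II (f n).+1)).
  by move=> e [].
apply/seteqP; split=> // g _.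
have [n ng] : exists n, (phi (coords g) n <= f n)%N.
  apply: contrapT => H; apply: (fP g); apply/nearooP; exists 0%N => n _.
  by rewrite leqNgt; apply/negP => /ltnW gf; apply: H; exists n.
have [gn gV] := phiP _ g erefl n.
exists n => //; exists (V (n, phi (coords g) n)).
  by exists (phi (coords g) n).
by have [_] := VP (n, phi (coords g) n) gV; exact.
Qed.

End SubgroupCoords.

(** * Properties of the branch group *)

Section BranchGroupProperties.
Variables (T : pointedType) (w : T -> nat -> nat * nat) (A : set T).
Local Notation G := (comb_group w A).
Implicit Types l : seq (bool * T).
Local Open Scope ring_scope.

Lemma comb_group_Hurewicz_bounded : Hurewicz_bounded (subgroup G).
Proof.
apply: Hurewicz_bounded_coords => g; have [l _ gl] := comb_groupP g.
by exists (size l) => i; rewrite gl; exact: comb_norm_le.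
Qed.

Lemma comb_group_Menger :
  (forall phi : seq (bool * T) -> nat -> nat, exists f,
    forall l, signed_words A l -> ~ le_star f (phi l)) ->
  Menger (subgroup G).
Proof.
move=> Ad; apply: Menger_coords => phi.
have [f fP] := Ad (phi \o comb w); exists f => g.
by have [l Al ->] := comb_groupP g; exact: fP.
Qed.

Let root := pickle ([::] : seq (nat * nat)).

Let level_set (t : seq (nat * nat)) : set (subgroup G) :=
  [set g | coords g root = 0 \/ coords g (pickle t) != 0].

Let level_cover n : set (set (subgroup G)) :=
  [set V | exists2 t, size t = n & V = level_set t].

Lemma level_open_cover n : open_cover (level_cover n).
Proof.
split=> [_ [t _ ->]|].
  apply: (@subgroup_open_coord _ (maxn root (pickle t)).+1
    (fun x => x root = 0 \/ x (pickle t) != 0)) => x y xy.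
  by rewrite !xy ?ltnS ?leq_maxl ?leq_maxr.
apply/seteqP; split=> // g _; have [l _ gl] := comb_groupP g.
have [g0|g0] := eqVneq (coords g root) 0.
  by exists (level_set (nseq n (0%N, 0%N))); [exists (nseq n (0%N, 0%N)); rewrite ?size_nseq|left].
have [|t [tn t0]] := @comb_level _ w l n; first by rewrite -gl.
by exists (level_set t); [exists t|right; rewrite gl].
Qed.

Lemma branch_mem i : A i -> exists g : subgroup G, coords g = branch (w i).
Proof.
move=> Ai; have lG : comb w [:: (false, i)] \in G.
  by apply: comb_group_mem => p; rewrite inE => /eqP->.
exists (exist (fun x : ZN => x \in G) _ lG); rewrite /coords /=.
by apply/funext => m; rewrite /comb big_seq1 mul1r.
Qed.

Lemma branch_level_set i (g : subgroup G) t : coords g = branch (w i) ->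
  level_set t g -> t = mkseq (w i) (size t).
Proof.
move=> gi; rewrite /level_set /= gi !branch_pickle eqxx => -[//|].
by have [//|_] := eqVneq t (mkseq (w i) (size t)); rewrite eqxx.
Qed.

Lemma comb_group_not_Hurewicz :
  (forall g, exists2 i, A i & ~ le_star (fun n => (w i n).2) g) ->
  ~ Hurewicz (subgroup G).
Proof.
move=> Aunb HG; have [F [Ffin Fcov]] := HG level_cover level_open_cover.
have /choice[t tP] (nV : nat * set (subgroup G)) : exists t, level_cover nV.1 nV.2 ->
    size t = nV.1 /\ nV.2 = level_set t.
  have [[t tn tV]|no] := pselect (level_cover nV.1 nV.2); first by exists t.
  by exists [::] => /no.
(* Reading the value at [n] takes a node of length [n + 1], whence the shift. *)
pose last_val n V := (nth (0%N, 0%N) (t (n.+1, V)) n).2.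
have /choice[g gP] n : exists K, forall V, F n.+1 V -> (last_val n V <= K)%N.
  have [K KP] := finite_nat_bound (finite_image (last_val n) (Ffin n.+1).1).
  by exists K => V FV; apply: KP; exists V.
have [i Ai] := Aunb g; apply; have [x xi] := branch_mem Ai.
have /nearooP[N NP] := Fcov x; apply/nearooP; exists N => n Nn.
have [V FV Vx] := NP n.+1 (leqW Nn).
have [tn tV] := tP (n.+1, V) ((Ffin n.+1).2 V FV).
move: Vx; rewrite [V]tV => /(branch_level_set xi) tw.
by have := gP n V FV; rewrite /last_val tw tn nth_mkseq.
Qed.

(* Running over the covers in infinitely many disjoint subsequences makes the guess
   correct infinitely often. *)
Lemma comb_group_not_Rothberger :
  (forall f, exists2 i, A i & exists N, forall n, (N <= n)%N -> f n <> (w i n).1) ->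
  ~ Rothberger (subgroup G).
Proof.
move=> Aev RG.
pose lev (k j : nat) := pickle (k, j).
have /choice[V VP] k : exists V : nat -> set (subgroup G),
    (forall j, level_cover (lev k j).+1 (V j)) /\ \bigcup_j V j = setT.
  by have [V VP] := RG _ (fun j => level_open_cover (lev k j).+1); exists V.
have /choice[t tP] (kj : nat * nat) : exists t, size t = (lev kj.1 kj.2).+1 /\
    V kj.1 kj.2 = level_set t.
  by have [t tn tV] := (VP kj.1).1 kj.2; exists t.
pose f n := let kj := odflt (0%N, 0%N) (unpickle n) in (nth (0%N, 0%N) (t kj) n).1.
have [i Ai [N fN]] := Aev f; have [x xi] := branch_mem Ai.
have /choice[j jP] k : exists j, V k j x.
  by have [j _ Vx] : (\bigcup_j V k j) x; [rewrite (VP k).2|exists j].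
have [|k Nk] := @injective_gtn (fun k => lev k (j k)) _ N.
  by move=> k k' /(pcan_inj pickleK)[].
apply: (fN _ (ltnW Nk)).
have [tn tV] := tP (k, j k); move: (jP k).
rewrite -[V k (j k)]/(V (k, j k).1 (k, j k).2) tV => /(branch_level_set xi) tw.
by rewrite /f pickleK /= tw tn nth_mkseq.
Qed.

Lemma comb_filter (a : pred T) l m :
  comb w l m = comb w [seq p <- l | a p.2] m + comb w [seq p <- l | ~~ a p.2] m.
Proof. by rewrite /comb !big_filter (bigID (fun p => a p.2)). Qed.

(** A node of [v] longer than [n] contains the entry [v n], too large for a node with code below
    [m]. *)
Lemma branch_support (v : nat -> nat * nat) n m :
  (forall c, (c < m)%N -> forall t : seq (nat * nat), pickle t = c ->
    ((nth (0%N, 0%N) t n).2 < (v n).2)%N) ->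
  forall c, (c < m)%N -> branch v c != 0 ->
    exists2 k, (k <= n)%N & c = pickle (mkseq v k).
Proof.
move=> vn c cm; rewrite /branch; have := @pickle_invK (seq (nat * nat)) c.
case: pickle_inv => [t /= tc|]; last by rewrite eqxx.
have [tv _|] := eqVneq t (mkseq v (size t)); last by rewrite eqxx.
exists (size t); last by rewrite -tv.
rewrite leqNgt; apply/negP => nt.
by have := vn c cm t tc; rewrite tv nth_mkseq // ltnn.
Qed.

(* Write [g] in the group as [h + r], where [r] collects the letters outside [X].  For
   almost all [n] in [I], the first [M n] coordinates of [r] have at most [(n + 1)^2]
   nonzero entries, hence vanish on one of the intervals [[p n k, p n (k + 1))]; so they
   are given there by an element of [box (p n k) n].  The points [p n k] are chosen to
   leave room for guessing all elements of this box in turn, and [h] is guessed on its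
   first [M n] coordinates using that there are few such [h]. *)
Lemma comb_group_Rothberger_bounded :
  (forall b : nat -> nat, exists (X : set T) (I : set nat),
    (forall i, A i -> ~ X i ->
       exists N, forall n, (N <= n)%N -> I n -> (b n < (w i n).2)%N) /\
    forall phi : seq (bool * T) -> nat -> nat, exists f, forall l, signed_words X l ->
       forall N, exists n, [/\ (N <= n)%N, I n & f n = phi l n]) ->
  Rothberger_bounded (subgroup G).
Proof.
move=> AX; apply: Rothberger_bounded_coords => m.
(* For every [q] in the box, guess number [pickle (n, q)] concerns only coordinates below
   [nxt (n, p)]. *)
have /choice[nxt nxtP] (np : nat * nat) : exists K, (np.2 <= K)%N /\
    forall q, box np.2 np.1 q -> (m (pickle (np.1, q)) <= K)%N.
  have [K KP] := finite_nat_bound (finite_image (fun q => m (pickle (np.1, q)))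
    (finite_box np.2 np.1)).
  exists (maxn np.2 K); split=> [|q Bq]; first exact: leq_maxl.
  by rewrite leq_max; apply/orP; right; apply: KP; exists q.
pose p n k := iter k (fun p => nxt (n, p)) 0%N.
have pmono n : {homo p n : k k' / (k <= k')%N}.
  apply: homo_leq => // [y x z|k]; first exact: leq_trans.
  by rewrite /p iterS; have [] := nxtP (n, p n k).
(* Of [(n + 1)^2 + 1] intervals, one avoids any given [(n + 1)^2] coordinates. *)
pose M n := p n (n.+1 * n.+1).+1.
have /choice[b bP] n : exists K, forall c, (c < M n)%N -> forall t : seq (nat * nat),
    pickle t = c -> ((nth (0%N, 0%N) t n).2 <= K)%N.
  pose v (c : nat) := (nth (0%N, 0%N) (odflt [::] (unpickle c : option (seq (nat * nat)))) n).2.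
  have [K KP] := finite_nat_bound (finite_image v (finite_II (M n))).
  exists K => c cM t tc; have -> : (nth (0%N, 0%N) t n).2 = v c.
    by rewrite /v -tc pickleK.
  by apply: KP; exists c.
have [X [I [XA Xguess]]] := AX b.
have [f fP] := Xguess (fun l n => pickle (mkseq (comb w l) (M n))).
(* Guess number [pickle (n, q)] adds the tuple [q], extended by zeros, to the [n]-th guess for the
   letters in [X]. *)
pose a j i : int := let nq : nat * seq int := odflt (0%N, [::]) (unpickle j) in
  nth 0 (odflt [::] (unpickle (f nq.1)) : seq int) i + nth 0 nq.2 i.
exists a => g; have [l Al ->] := comb_groupP g.
pose lX := [seq x <- l | `[< X x.2 >]]; pose lY := [seq x <- l | ~~ `[< X x.2 >]].
have lE i : comb w l i = comb w lX i + comb w lY i by exact: (comb_filter (fun i => `[< X i >])).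
have lXX : signed_words X lX by move=> x; rewrite mem_filter => /andP[/asboolP].
have [N NP] : exists N, forall n, (N <= n)%N -> forall x, x \in lY ->
    I n -> (b n < (w x.2 n).2)%N.
  apply: seq_eventually => x; rewrite mem_filter => /andP[/= /asboolP Xx /Al Ax].
  exact: XA.
(* Taking [n >= size lY] bounds the coordinates of [comb w lY] by [n] and the size of [S] by
   [(n + 1)^2]. *)
have [n [+ In fn]] := fP lX lXX (maxn N (size lY)).
rewrite geq_max => /andP[Nn ln].
pose S := [seq pickle (mkseq (w x.2) k) | x <- lY, k <- iota 0 n.+1].
have lYS c : (c < M n)%N -> c \notin S -> comb w lY c = 0.
  move=> cM cS; rewrite /comb big1_seq // => x /andP[_ xl].
  apply/eqP; rewrite mulf_eq0 signr_eq0 /=; apply: contraNT cS.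
  move=> x0; have [|k kn ->] := @branch_support (w x.2) n (M n) _ c cM x0.
    move=> c' c'M t tc; exact: leq_ltn_trans (bP n c' c'M t tc) (NP n Nn x xl In).
  by apply/allpairsP; exists (x, k); split=> //; rewrite mem_iota leq0n ltnS.
have [k kS kgap] := gap S (pmono n).
have kn : (k <= n.+1 * n.+1)%N.
  apply: leq_trans kS _; rewrite size_allpairs size_iota leq_mul2r.
  by rewrite (leq_trans ln) ?orbT.
have kM : (p n k.+1 <= M n)%N by apply: pmono; rewrite ltnS.
pose q := mkseq (comb w lY) (p n k).
have Bq : box (p n k) n q.
  split; first by rewrite size_mkseq.
  move=> _ /mapP[i _ ->]; apply: le_trans (comb_norm_le _ _ _) _.
  by rewrite ler_nat.
exists (pickle (n, q)) => i im.
have ip : (i < p n k.+1)%N.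
  apply: leq_trans im _; rewrite /p iterS -/(p n k).
  by have [_] := nxtP (n, p n k); exact.
have -> : a (pickle (n, q)) i = nth 0 (odflt [::] (unpickle (f n)) : seq int) i + nth 0 q i.
  by rewrite /a pickleK.
rewrite fn pickleK [odflt _ _]/= nth_mkseq ?(leq_trans ip) // lE; congr (_ + _).
(* Below [p n k] the tuple [q] is exact; from there up to [p n k.+1] both sides vanish, by the gap
   and by the default of [nth]. *)
have [ipk|pki] := ltnP i (p n k); first by rewrite nth_mkseq.
rewrite nth_default ?size_mkseq // lYS ?(leq_trans ip) //.
by apply/negP => /kgap; apply; rewrite pki.
Qed.

End BranchGroupProperties.

(* [B], [C] and [D] have cardinality b, cov(M) and d. *)
Theorem theorem9p11 (R : realType)
    (B : set (nat -> nat)) (C : set (set R)) (D : set (nat -> nat)) :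
  min_card_witness unbounded B ->
  min_card_witness (@meager_cover R) C ->
  min_card_witness dominating D ->
  B #= C ->
  C #< D ->
  exists G : zmodClosed ZN,
    Hurewicz_bounded (subgroup G) /\
    Menger_bounded (subgroup G) /\
    Rothberger_bounded (subgroup G) /\
    Menger (subgroup G) /\
    ~ Hurewicz (subgroup G) /\
    ~ Rothberger (subgroup G).
Proof.
move=> Bw Cw Dw BC [_ DC].
have [A [s [AB sP]]] := b_scale Bw.
have Bunc := unbounded_uncountable Bw.1.
have [y yP] := no_guessing Cw.1 Dw DC.
have AC : A #= C := card_eq_trans AB BC.
have [c [_ _ cAC]] := card_set_bijP AC.
(* [c] maps [A] onto [C], so the reindexed family still evades every guess. *)
pose w i n := (y (c i) n, s i n).
have HG := @comb_group_Hurewicz_bounded _ w A.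
exists (comb_group w A : zmodClosed ZN); split; first exact: HG.
split; first exact: Hurewicz_bounded_Menger HG.
split.
  apply: comb_group_Rothberger_bounded => b.
  have [X [I [BX Iinf XP]]] := sP b; exists X, I; split=> // phi.
  (* [X] has fewer than kappa letters, hence fewer than kappa signed words, kappa being
     uncountable. *)
  apply: small_family_guess Cw _ Iinf => CX.
  by apply: (not_card_le_signed_words Bunc BX); rewrite (card_le_eql BC).
split.
  (* Otherwise the functions [phi l], at most kappa many, would form a dominating family. *)
  apply: comb_group_Menger => phi; apply: contrapT => H.
  have Ainf : infinite_set A.
    move=> /finite_set_countable Acnt; apply: Bunc.
    by rewrite /countable -(card_le_eql AB).
  apply: DC; rewrite -(card_le_eqr AC).
  apply: card_le_trans (signed_words_card_le Ainf).
  apply: card_le_trans (card_image_le phi _).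
  apply: Dw.2 => f; apply: contrapT => H'; apply: H; exists f => l Al fl.
  by apply: H'; exists (phi l) => //; exists l.
split.
  apply: comb_group_not_Hurewicz => g.
  have [X [I [BX Iinf XP]]] := sP g.
  have [i [Ai Xi]] : exists i, A i /\ ~ X i.
    apply: contrapT => H; apply: BX; rewrite -(card_le_eql AB).
    apply: subset_card_le => i Ai; apply: contrapT => Xi; apply: H.
    by exists i.
  exists i => // /nearooP[N NP]; have [M MP] := XP i Ai Xi.
  have [n + In] := Iinf (maxn N M); rewrite geq_max => /andP[/NP sg /MP/(_ In)].
  by rewrite ltnNge sg.
apply: comb_group_not_Rothberger => f.
have [E CE [N EN]] := yP f; have [i Ai ciE] := cAC E CE.
by exists i => //; exists N => n Nn; rewrite /w ciE; exact: EN.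
Qed.
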